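(* The direct limit $DH_{n,\infty}(X)=\varinjlim_{r}\widetilde{DH}_{n,r}(X)$, as $r\to\infty$, is a coarse invariant of $X$. Precisely: if $X,Y$ are coarsely connected proper metric spaces which are bornotopy equivalent through the map $f:X\to Y$, then $$DH_{n,\infty}(X)\cong DH_{n,\infty}(Y)\qquad\text{for all } n,$$ and the isomorphism is given by the canonical map $f_*$ induced by $f$.
   Context: **Discrete homology at scale $r$** of a metric space $(X,d)$, for $r>0$. Let $Q_n=\{0,1\}^n$ with the Hamming distance. A singular $(n,r)$-cube in $X$ is an $r$-Lipschitz map $\sigma:Q_n\to X$, i.e. $d(\sigma(a),\sigma(b))\le r\,d_{Q_n}(a,b)$ for all $a,b$. Let $L_{n,r}(X)$ be the free abelian group on the singular $(n,r)$-cubes. For $n\ge1$ and $1\le i\le n$ put $(A_i^n\sigma)(a_1,\dots,a_{n-1})=\sigma(a_1,\dots,a_{i-1},0,a_i,\dots,a_{n-1})$ and $(B_i^n\sigma)(a_1,\dots,a_{n-1})=\sigma(a_1,\dots,a_{i-1},1,a_i,\dots,a_{n-1})$. The cube $\sigma$ is degenerate if $A_i^n\sigma=B_i^n\sigma$ for some $i$. Let $D_{n,r}(X)$ be the subgroup generated by the degenerate cubes and $C_{n,r}(X)=L_{n,r}(X)/D_{n,r}(X)$. The boundary $\partial\sigma=\sum_{i=1}^n(-1)^i(A_i^n\sigma-B_i^n\sigma)$ induces $\partial_n:C_{n,r}(X)\to C_{n-1,r}(X)$, and $DH_{n,r}(X)=\ker\partial_n/\operatorname{Im}\partial_{n+1}$.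 **Coarse notions.** A metric space is proper if its closed balls are compact. It is coarsely connected if it is connected at some scale $r>0$, i.e. any two points can be joined by a finite sequence of points with consecutive distances $\le r$. A map $f:X\to Y$ of proper metric spaces is proper if preimages of compact sets are compact. It is uniformly bornologous if there is a function $S:(0,\infty)\to(0,\infty)$ such that for all $r>0$, $d_X(x_1,x_2)<r$ implies $d_Y(f(x_1),f(x_2))<S(r)$. $UBP(X,Y)$ is the set of uniformly bornologous proper maps $X\to Y$. Maps $f,g\in UBP(X,Y)$ are bornotopy equivalent if there is $R>0$ with $d_Y(f(x),g(x))<R$ for all $x\in X$. A map $f\in UBP(X,Y)$ is a bornotopy equivalence if there is $g\in UBP(Y,X)$ such that $f\circ g$ is bornotopy equivalent to $\mathrm{Id}_Y$ and $g\circ f$ is bornotopy equivalent to $\mathrm{Id}_X$. **Coarse homology.** For a coarsely connected $X$, the index $r$ ranges over values large enough that $X$ is connected at scale $r$. Put $\widetilde{DH}_{n,r}(X)=\prod_{k=1}^\infty DH_{n,r}(X)$. For $r\le s$, every $(n,r)$-cube is an $(n,s)$-cube; this induces $DH_{n,r}(X)\to DH_{n,s}(X)$ and, component-wise, $\widetilde{DH}_{n,r}(X)\to\widetilde{DH}_{n,s}(X)$. These form a direct system with direct limit $DH_{n,\infty}(X)$. **Induced map.** Let $f\in UBP(X,Y)$. Given $r$, choose $s$ large enough that $d_X(x_1,x_2)\le r$ implies $d_Y(f(x_1),f(x_2))\le s$. Then $\sigma\mapsto f\circ\sigma$ induces $DH_{n,r}(X)\to DH_{n,s}(Y)$, hence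 component-wise $\widetilde{DH}_{n,r}(X)\to\widetilde{DH}_{n,s}(Y)$, and in the limit the canonical map $f_*:DH_{n,\infty}(X)\to DH_{n,\infty}(Y)$, independent of the choices of $s$. *)

(* Defs.v *)
From HB Require Import structures.
From mathcomp Require Import all_boot all_order all_algebra.
From mathcomp Require Import generic_quotient ring_quotient freeg.
From mathcomp Require Import zify.
From mathcomp Require Import boolp classical_sets functions reals.
From mathcomp Require Import topology_structure compact metric_structure.

Set Implicit Arguments.
Unset Strict Implicit.
Unset Printing Implicit Defensive.

Import Order.TTheory GRing.Theory Num.Theory.

Local Open Scope classical_set_scope.
Local Open Scope quotient_scope.
Local Open Scope ring_scope.

Section GeneratedSubgroup.
Variables (V : zmodType) (S : set V).

Definition subgroup_gen : {pred V} :=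
  [pred x | x \in smallest (fun H : set V => zmod_closed [in H]) S].

Lemma subgroup_genP x :
  reflect (forall H : {pred V}, zmod_closed H -> (forall y, S y -> y \in H) -> x \in H)
          (x \in subgroup_gen).
Proof.
apply: (iffP idP) => [|h]; rewrite -topredE /=.
  move=> /set_mem xS H [H0 HB] SH; apply: (xS [set` H]).
  by split=> [|y /SH//]; split=> [|u v]; rewrite ?inE//=; exact: HB.
apply/mem_set => H [Hz SH].
by apply/set_mem/(h [in H] Hz) => y /SH /mem_set.

Qed.

Lemma subgroup_gen_sub y : S y -> y \in subgroup_gen.
Proof. by move=> Sy; apply/subgroup_genP => H _; exact. Qed.

Lemma subgroup_gen_closed : zmod_closed subgroup_gen.
Proof.
split=> [|x y /subgroup_genP hx /subgroup_genP hy].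
  by apply/subgroup_genP => H [].
apply/subgroup_genP => H Hz SH.
by case: (Hz) => _; apply; [exact: hx|exact: hy].
Qed.

HB.instance Definition _ :=
  GRing.isZmodClosed.Build V subgroup_gen subgroup_gen_closed.

End GeneratedSubgroup.

Lemma subgroup_gen_homo (V W : zmodType) (S : set V) (J : zmodClosed W)
    (f : {additive V -> W}) :
  (forall x, S x -> f x \in J) -> forall x, x \in subgroup_gen S -> f x \in J.
Proof.
move=> SJ x /subgroup_genP /(_ [pred x | f x \in J]); apply => //.
split=> [|u v]; rewrite !inE ?raddf0 ?rpred0// => fu fv.
by rewrite raddfB rpredB.
Qed.

Section QuotientMap.
Variables (V W : zmodType) (I : zmodClosed V) (J : zmodClosed W).
Variables (f : {additive V -> W}) (fIJ : forall x, x \in I -> f x \in J).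

Definition quot_map of (forall x, x \in I -> f x \in J) :=
  fun x : Quotient.quot I => \pi_(Quotient.quot J) (f (repr x)).

Lemma quot_mapE x : 
  quot_map fIJ (\pi_(Quotient.quot I) x) = \pi_(Quotient.quot J) (f x).
Proof.
apply/eqP; rewrite -Quotient.idealrBE -raddfB; apply: fIJ.
by rewrite Quotient.idealrBE reprK.
Qed.

Lemma quot_map_morphism : zmod_morphism (quot_map fIJ).
Proof.
elim/quotW => x; elim/quotW => y.
by rewrite -[_ - _]raddfB !quot_mapE !raddfB.
Qed.

HB.instance Definition _ :=
  GRing.isZmodMorphism.Build (Quotient.quot I) (Quotient.quot J)
    (quot_map fIJ) quot_map_morphism.

End QuotientMap.

Arguments quot_map : simpl never.

Section Homology.
Variables (U V W : zmodType) (d1 : {additive U -> V}) (d0 : {additive V -> W}).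

Definition kernel : {pred V} := [pred x | d0 x == 0].

Lemma kernel_closed : zmod_closed kernel.
Proof.
split=> [|x y]; rewrite !inE ?raddf0// => /eqP dx /eqP dy.
by rewrite raddfB dx dy subr0.
Qed.

HB.instance Definition _ := GRing.isZmodClosed.Build V kernel kernel_closed.

Record cycle := Cycle { cycle_val : V; cycleP : cycle_val \in kernel }.

HB.instance Definition _ := [isSub for cycle_val].
HB.instance Definition _ := [Choice of cycle by <:].
HB.instance Definition _ := [SubChoice_isSubZmodule of cycle by <:].

Definition boundaries : {pred cycle} :=
  [pred z | `[< exists u, d1 u = cycle_val z >]].

Lemma boundaries_closed : zmod_closed boundaries.
Proof.
split=> [|x y].
  by apply/asboolP; exists 0; rewrite !raddf0.
move=> /asboolP[u du] /asboolP[v dv]; apply/asboolP; exists (u - v).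
by rewrite raddfB du dv.
Qed.

HB.instance Definition _ :=
  GRing.isZmodClosed.Build cycle boundaries boundaries_closed.

Definition homology : zmodType := Quotient.quot boundaries.

End Homology.

Arguments kernel {V W} d0 _.
Arguments boundaries {U V W} d1 d0 _.

Section HomologyMap.
Variables (U V W U' V' W' : zmodType).
Variables (d1 : {additive U -> V}) (d0 : {additive V -> W}).
Variables (d1' : {additive U' -> V'}) (d0' : {additive V' -> W'}).
Variables (f2 : {additive U -> U'}) (f1 : {additive V -> V'}).
Variable (f0 : {additive W -> W'}).
Hypothesis f1d : forall x, f1 (d1 x) = d1' (f2 x).
Hypothesis f0d : forall x, f0 (d0 x) = d0' (f1 x).

Lemma cycle_map_subproof (z : cycle d0) : f1 (cycle_val z) \in kernel d0'.
Proof. by case: z => z /= /eqP dz; rewrite inE -f0d dz raddf0. Qed.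

Definition cycle_map (z : cycle d0) : cycle d0' := Cycle (cycle_map_subproof z).

Lemma cycle_map_morphism : zmod_morphism (cycle_map).
Proof. by move=> x y; apply: val_inj; rewrite /= raddfB. Qed.

HB.instance Definition _ := GRing.isZmodMorphism.Build
  (cycle d0) (cycle d0') (cycle_map) cycle_map_morphism.

Lemma homology_map_subproof (z : cycle d0) :
  z \in boundaries d1 d0 -> cycle_map z \in boundaries d1' d0'.
Proof.
move=> /asboolP[u du]; apply/asboolP; exists (f2 u).
by rewrite -f1d du.
Qed.

Definition homology_map :
    {additive homology d1 d0 -> homology d1' d0'} :=
  quot_map homology_map_subproof.

Lemma homology_mapE (z : cycle d0) :
  homology_map (\pi_(Quotient.quot (boundaries d1 d0)) z) =
  \pi_(Quotient.quot (boundaries d1' d0')) (cycle_map z).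
Proof. exact: quot_mapE. Qed.

End HomologyMap.

Section DirectLimit.

Record directSystem := DirectSystem {
  ds_index : choiceType;
  ds_le : rel ds_index;
  ds_obj : ds_index -> zmodType;
  ds_map : forall i j, ds_le i j -> {additive ds_obj i -> ds_obj j};
  ds_point : ds_index;
  ds_le_refl : reflexive ds_le;
  ds_le_trans : transitive ds_le;
  ds_directed : forall i j, exists k, ds_le i k && ds_le j k;
  ds_map_id : forall i (h : ds_le i i) x, ds_map h x = x;
  ds_map_comp : forall i j k (hij : ds_le i j) (hjk : ds_le j k)
    (hik : ds_le i k) x, ds_map hjk (ds_map hij x) = ds_map hik x
}.

Variable D : directSystem.
Local Notation I := (ds_index D).
Local Notation A := (@ds_obj D).
Local Notation tot := ({i : I & A i})%type.

(* two elements are identified when they become equal at a later stage *)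
Definition dlim_equiv (x y : tot) :=
  `[< exists k (hx : ds_le (tag x) k) (hy : ds_le (tag y) k),
      ds_map hx (tagged x) = ds_map hy (tagged y) >].

Lemma dlim_equiv_class : equiv_class_of dlim_equiv.
Proof.
split=> [x|x y|y x z].
- by apply/asboolP; exists (tag x), (ds_le_refl _), (ds_le_refl _).
- by apply/asboolP/asboolP => -[k [hx [hy e]]]; exists k, hy, hx.
move=> /asboolP[k [hx [hy e]]] /asboolP[l [hy' [hz e']]]; apply/asboolP.
have [m /andP[km lm]] := ds_directed k l.
exists m, (ds_le_trans hx km), (ds_le_trans hz lm).
rewrite -(ds_map_comp hx km) e -(ds_map_comp hz lm) -e'.
by rewrite (ds_map_comp _ _ (ds_le_trans hy km)) (ds_map_comp _ _ (ds_le_trans hy km)).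
Qed.

Canonical dlim_equiv_rel := EquivRelPack dlim_equiv_class.
Canonical dlim_encModRel := defaultEncModRel dlim_equiv.

Definition dlim := {eq_quot dlim_equiv}.
HB.instance Definition _ := Choice.on dlim.
HB.instance Definition _ := EqQuotient.on dlim.

Definition dlim_in i (a : A i) : dlim := \pi_dlim (Tagged A a).

Lemma dlim_inP i j (a : A i) (b : A j) :
  dlim_in a = dlim_in b <->
  exists k (hi : ds_le i k) (hj : ds_le j k), ds_map hi a = ds_map hj b.
Proof. by split=> [/eqmodP/asboolP//|h]; apply/eqmodP/asboolP. Qed.

Lemma dlim_in_map i j (h : ds_le i j) (a : A i) : dlim_in (ds_map h a) = dlim_in a.
Proof. by apply/dlim_inP; exists j, (ds_le_refl j), h; rewrite ds_map_id. Qed.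

Definition dlim_index (x : dlim) : I := tag (repr x).
Definition dlim_elt (x : dlim) : A (dlim_index x) := tagged (repr x).

Lemma dlim_eltK x : dlim_in (dlim_elt x) = x.
Proof.
by rewrite /dlim_in /dlim_elt /dlim_index; case: (repr x) (reprK x) => i a.
Qed.

Lemma dlim_surj2 (x y : dlim) :
  exists k (a b : A k), x = dlim_in a /\ y = dlim_in b.
Proof.
have [k /andP[xk yk]] := ds_directed (dlim_index x) (dlim_index y).
exists k, (ds_map xk (dlim_elt x)), (ds_map yk (dlim_elt y)).
by rewrite !dlim_in_map !dlim_eltK.
Qed.

Definition dlim_zero : dlim := dlim_in (0 : A (ds_point D)).
Definition dlim_opp (x : dlim) : dlim := dlim_in (- dlim_elt x).
Definition dlim_add (x y : dlim) : dlim :=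
  let k := xchoose (ds_directed (dlim_index x) (dlim_index y)) in
  let h := xchooseP (ds_directed (dlim_index x) (dlim_index y)) in
  dlim_in (ds_map (proj1 (andP h)) (dlim_elt x)
           + ds_map (proj2 (andP h)) (dlim_elt y) : A k).

Lemma dlim_in0 i : dlim_in (0 : A i) = dlim_zero.
Proof.
have [k /andP[ik pk]] := ds_directed i (ds_point D).
by apply/dlim_inP; exists k, ik, pk; rewrite !raddf0.
Qed.

Lemma dlim_inN i (a : A i) : dlim_in (- a) = dlim_opp (dlim_in a).
Proof.
have /dlim_inP[k [hi [hj e]]] := esym (dlim_eltK (dlim_in a)).
by apply/dlim_inP; exists k, hi, hj; rewrite !raddfN e.
Qed.

Lemma dlim_inD i (a b : A i) :
  dlim_in (a + b) = dlim_add (dlim_in a) (dlim_in b).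
Proof.
rewrite /dlim_add; set x := dlim_in a; set y := dlim_in b.
set h := xchooseP _; set k := xchoose _ in h *.
case/andP: (h) => xk yk.
rewrite (bool_irrelevance (proj1 (andP h)) xk).
rewrite (bool_irrelevance (proj2 (andP h)) yk).
have /dlim_inP[l [hl [hl' el]]] := esym (dlim_eltK x).
have /dlim_inP[m [hm [hm' em]]] := esym (dlim_eltK y).
have [n1 /andP[ln mn]] := ds_directed l m.
have [n /andP[nn kn]] := ds_directed n1 k.
have ln' := ds_le_trans ln nn; have mn' := ds_le_trans mn nn.
have in_ := ds_le_trans hl ln'.
apply/dlim_inP; exists n, in_, kn; rewrite !raddfD; congr (_ + _).
  rewrite -(ds_map_comp hl ln') el (ds_map_comp _ _ (ds_le_trans xk kn)).
  by rewrite (ds_map_comp _ _ (ds_le_trans xk kn)).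
rewrite -(ds_map_comp hm mn') em (ds_map_comp _ _ (ds_le_trans yk kn)).
by rewrite (ds_map_comp _ _ (ds_le_trans yk kn)).
Qed.

Lemma dlim_addA : associative dlim_add.
Proof.
move=> x y z; have [i [a [b [-> ->]]]] := dlim_surj2 x y.
have [k /andP[ik zk]] := ds_directed i (dlim_index z).
rewrite -(dlim_in_map ik a) -(dlim_in_map ik b) -(dlim_eltK z).
by rewrite -(dlim_in_map zk) -!dlim_inD addrA.
Qed.

Lemma dlim_addC : commutative dlim_add.
Proof.
by move=> x y; have [i [a [b [-> ->]]]] := dlim_surj2 x y; rewrite -!dlim_inD addrC.
Qed.

Lemma dlim_add0 : left_id dlim_zero dlim_add.
Proof.
by move=> x; rewrite -(dlim_eltK x) -(dlim_in0 (dlim_index x)) -dlim_inD add0r.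
Qed.

Lemma dlim_addN : left_inverse dlim_zero dlim_opp dlim_add.
Proof. by move=> x; rewrite -(dlim_eltK x) -dlim_inN -dlim_inD addNr dlim_in0. Qed.

HB.instance Definition _ :=
  GRing.isZmodule.Build dlim dlim_addA dlim_addC dlim_add0 dlim_addN.

Lemma dlim_in_morphism i : zmod_morphism (@dlim_in i).
Proof. by move=> a b; rewrite dlim_inD dlim_inN. Qed.

HB.instance Definition _ i :=
  GRing.isZmodMorphism.Build (A i) dlim (@dlim_in i) (@dlim_in_morphism i).

End DirectLimit.

Section DirectLimitMap.
Variables D E : directSystem.
Variables (t : ds_index D -> ds_index E).
Variable g : forall i, {additive ds_obj i -> ds_obj (t i)}.

Definition dlim_compatible := forall i j (h : ds_le i j) (a : ds_obj i),
  dlim_in (g j (ds_map h a)) = dlim_in (g i a).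

Definition dlim_map of dlim_compatible :=
  fun x : dlim D => dlim_in (g _ (dlim_elt x)).

Hypothesis gP : dlim_compatible.

Lemma dlim_mapE i (a : ds_obj i) : dlim_map gP (dlim_in a) = dlim_in (g i a).
Proof.
have /dlim_inP[k [hi [hj e]]] := dlim_eltK (dlim_in a).
by rewrite /dlim_map -(gP hi) e gP.
Qed.

Lemma dlim_map_morphism : zmod_morphism (dlim_map gP).
Proof.
move=> x y; have [i [a [b [-> ->]]]] := dlim_surj2 x y.
by rewrite -raddfB !dlim_mapE !raddfB.
Qed.

HB.instance Definition _ :=
  GRing.isZmodMorphism.Build (dlim D) (dlim E) (dlim_map gP) dlim_map_morphism.

End DirectLimitMap.

Section Hypercube.
Variable n : nat.

Definition hypercube := {ffun 'I_n -> bool}.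
HB.instance Definition _ := Finite.on hypercube.

Definition hamming (a b : hypercube) : nat := #|[pred i | a i != b i]|.

Lemma hamming_eq0 a b : hamming a b = 0%N -> a = b.
Proof.
by move=> /card0_eq e; apply/ffunP => i; have /negbFE/eqP := e i.
Qed.

Lemma hammingxx a : hamming a a = 0%N.
Proof. by apply: eq_card0 => i; rewrite !inE eqxx. Qed.

Definition insert_coord (i : 'I_n) (e : bool) (a : {ffun 'I_n.-1 -> bool}) :
    hypercube :=
  [ffun j => if unlift i j is Some k then a k else e].

End Hypercube.

Lemma hamming_insert n (i : 'I_n) e (a b : hypercube n.-1) :
  hamming (insert_coord i e a) (insert_coord i e b) = hamming a b.
Proof.
rewrite /hamming -(card_imset _ (@lift_inj n i)); apply: eq_card => j.
rewrite !inE !ffunE; case: unliftP => [k ->|->].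
  by rewrite mem_imset ?inE//; exact: lift_inj.
rewrite eqxx; apply/esym/negP => /imsetP[k _ /eqP].
by rewrite (negPf (neq_lift _ _)).
Qed.

Section Cubes.
Variables (R : realType) (X : metricType R).

Definition is_cube n (r : R) (s : {ffun hypercube n -> X}) : bool :=
  [forall a, forall b, mdist (s a) (s b) <= r * (hamming a b)%:R].

Record cube (n : nat) (r : R) :=
  Cube { cube_fun :> {ffun hypercube n -> X}; cubeP : is_cube r cube_fun }.

HB.instance Definition _ n r := [isSub for @cube_fun n r].
HB.instance Definition _ n r := [Choice of cube n r by <:].

Lemma cube_lipschitz n r (s : cube n r) a b :
  mdist (s a) (s b) <= r * (hamming a b)%:R.
Proof. exact: (forallP (forallP (cubeP s) a) b). Qed.

Lemma adjacent_is_cube n r (s : {ffun hypercube n -> X}) :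
  (forall a b, hamming a b = 1%N -> mdist (s a) (s b) <= r) -> is_cube r s.
Proof.
move=> sr; apply/forallP => a; apply/forallP => b.
have [h] := ubnP (hamming a b); elim: h a => // h IH a; rewrite ltnS => hab.
have [/hamming_eq0 ->|ab] := eqVneq (hamming a b) 0%N.
  by rewrite mdistxx hammingxx mulr0.
have /card_gt0P[i] : (0 < hamming a b)%N by rewrite lt0n.
rewrite inE => abi; pose c : hypercube n := [ffun j => if j == i then b j else a j].
have ac : hamming a c = 1%N.
  rewrite /hamming -(card1 i); apply: eq_card => j; rewrite !inE !ffunE.
  by have [->|] := eqVneq j i; rewrite ?eqxx.
have cb : hamming a b = (hamming c b).+1.
  rewrite /hamming (cardD1 i) inE abi add1n; congr _.+1; apply: eq_card => j.
  rewrite !inE !ffunE; by have [->|] := eqVneq j i; rewrite ?eqxx.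
rewrite cb -natr1 mulrDr mulr1 addrC; apply: le_trans (metric_triangle _ (s c) _) _.
by apply: lerD; [exact: sr|apply: IH; rewrite -cb].
Qed.

Section Faces.
Variables (n : nat) (r : R).

Lemma face_subproof (i : 'I_n) e (s : cube n r) :
  is_cube r [ffun a : hypercube n.-1 => s (insert_coord i e a)].
Proof.
apply/forallP => a; apply/forallP => b; rewrite !ffunE.
by rewrite -(hamming_insert i e a b) cube_lipschitz.
Qed.

(* A_i is [face i false] and B_i is [face i true] *)
Definition face (i : 'I_n) (e : bool) (s : cube n r) : cube n.-1 r :=
  Cube (face_subproof i e s).

Definition degenerate (s : cube n r) : bool :=
  [exists i : 'I_n, face i false s == face i true s].

Definition degenerate_chain : {pred {freeg (cube n r)}} :=
  subgroup_gen [set << s >> | s in [set s : cube n r | degenerate s]].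
HB.instance Definition _ := GRing.ZmodClosed.on degenerate_chain.

End Faces.
End Cubes.

Notation cubical_chain X n r := {freeg (cube X n r)}.

Arguments degenerate_chain {R} X n r _.

Section Boundary.
Variables (R : realType) (X : metricType R) (n : nat) (r : R).
Implicit Types s : cube X n r.

(* the exponent is [i.+1] because ordinals start at 0; for n = 0 the sum is
   empty, so the boundary vanishes in degree 0 *)
Definition cube_boundary s : cubical_chain X n.-1 r :=
  \sum_(i < n) (-1) ^+ i.+1 *: (<< face i false s >> - << face i true s >>).

Definition boundary : cubical_chain X n r -> cubical_chain X n.-1 r :=
  fglift cube_boundary.

HB.instance Definition _ :=
  GRing.isZmodMorphism.Build (cubical_chain X n r) (cubical_chain X n.-1 r)
    boundary (lift_is_additive cube_boundary).

Lemma boundaryU s : boundary << s >> = cube_boundary s.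
Proof. by rewrite /boundary liftU scale1r. Qed.

Lemma face_insertE i e s a : face i e s a = s (insert_coord i e a).
Proof. by rewrite /face /= ffunE. Qed.

Lemma insert_restrict (i : 'I_n) (v : hypercube n) :
  insert_coord i (v i) [ffun m => v (fintype.lift i m)] = v.
Proof.
by apply/ffunP => j; rewrite ffunE; case: unliftP => [k ->|->]//; rewrite ffunE.
Qed.

Lemma face_degenerate i j e s :
  face i false s = face i true s -> j != i -> degenerate (face j e s).
Proof.
move=> si ji; have [k ik jk] := unlift_some ji.
apply/existsP; exists k; apply/eqP/val_inj/ffunP => a; rewrite /= !ffunE /=.
pose v c := insert_coord j e (insert_coord k c a).
have vi c : v c i = c by rewrite !ffunE ik liftK ffunE unlift_none.
have vE : [ffun m => v false (fintype.lift i m)] =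
          [ffun m => v true (fintype.lift i m)].
  apply/ffunP => m; rewrite !ffunE.
  case: unliftP => // l lE; rewrite !ffunE; case: unliftP => // lk.
  by move: (neq_lift i m); rewrite lE lk -ik eqxx.
have := congr1 (fun t : cube X n.-1 r => t [ffun m => v true (fintype.lift i m)]) si.
rewrite !face_insertE -{1}vE -{1}(vi false) insert_restrict.
by rewrite -{1}(vi true) insert_restrict.
Qed.

Lemma boundary_degenerate c :
  c \in degenerate_chain X n r -> boundary c \in degenerate_chain X n.-1 r.
Proof.
apply: subgroup_gen_homo => _ [s /existsP[i /eqP si] <-].
rewrite /= boundaryU; apply: rpred_sum => j _.
have [->|ji] := eqVneq j i; first by rewrite si subrr scaler0 rpred0.
have fD e : << face j e s >> \in degenerate_chain X n.-1 r.
  by apply: subgroup_gen_sub; exists (face j e s) => //; exact: face_degenerate si ji.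
by rewrite -signr_odd scaler_sign; case: odd; rewrite ?rpredN rpredB.
Qed.

End Boundary.

Lemma freeg_additive_ext (K : choiceType) (V : zmodType)
    (f g : {additive {freeg K} -> V}) :
  (forall k, f << k >> = g << k >>) -> f =1 g.
Proof.
move=> fg D; rewrite -(freeg_sumE D) !raddf_sum; apply: eq_bigr => z _.
by rewrite -[coeff z D]intz -freegU_mulz !raddfMz fg.
Qed.

Section BoundaryBoundary.
Variables (R : realType) (X : metricType R) (n : nat) (r : R).

(* the position of coordinate [i] once coordinate [lift i j] is deleted *)
Definition swap_coord (i : 'I_n) (j : 'I_n.-1) : 'I_n.-1 :=
  odflt j (unlift (fintype.lift i j) i).

Lemma swap_coordK i j :
  fintype.lift (fintype.lift i j) (swap_coord i j) = i.
Proof.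
rewrite /swap_coord; case: unliftP => //= e.
by move: (neq_lift i j); rewrite -e eqxx.
Qed.

Lemma swap_coordE (i : 'I_n) (j : 'I_n.-1) :
  swap_coord i j = (if j < i then i.-1 else i)%N :> nat.
Proof.
have := congr1 val (swap_coordK i j); rewrite /= /bump.
by case: (leqP i j) => ij; rewrite ?add1n ?add0n; case: leqP => /=; lia.
Qed.

Lemma insert_swap (i : 'I_n) (j : 'I_n.-1) e e' (a : hypercube n.-1.-1) :
  insert_coord i e (insert_coord j e' a : hypercube n.-1) =
  insert_coord (fintype.lift i j) e'
    (insert_coord (swap_coord i j) e a : hypercube n.-1).
Proof.
apply/ffunP => k; rewrite !ffunE.
case: (unliftP i k) => [k' kE|->]; last first.
  have -> : unlift (fintype.lift i j) i = Some (swap_coord i j).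
    by rewrite -[X in unlift _ X](swap_coordK i j) liftK.
  by rewrite ffunE unlift_none.
rewrite ffunE kE; case: (unliftP j k') => [l lE|->]; last by rewrite unlift_none.
have -> : fintype.lift i k' =
          fintype.lift (fintype.lift i j) (fintype.lift (swap_coord i j) l).
  apply: val_inj; rewrite lE /= swap_coordE /bump.
  by case: (leqP i j) => ij; case: (leqP j l) => jl; case: leqP; case: leqP; lia.
by rewrite liftK ffunE liftK.
Qed.

Lemma face_face (i : 'I_n) (j : 'I_n.-1) e e' (s : cube X n r) :
  face j e' (face i e s) = face (swap_coord i j) e (face (fintype.lift i j) e' s).
Proof. by apply/val_inj/ffunP => a; rewrite /= !ffunE /= insert_swap. Qed.

Lemma cube_boundaryE m (s : cube X m r) :
  cube_boundary s =
  \sum_(p : 'I_m * bool) (-1) ^+ (p.1.+1 + p.2) *: << face p.1 p.2 s >>.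
Proof.
rewrite -(pair_bigA _ (fun (i : 'I_m) (e : bool) =>
  (-1) ^+ (i.+1 + e) *: << face i e s >> : cubical_chain X m.-1 r)) /=.
apply: eq_bigr => i _; rewrite big_bool /= addn1 addn0 (exprS _ i.+1) mulN1r.
by rewrite scaleNr scalerBr addrC.
Qed.

Lemma boundary_boundary (x : cubical_chain X n r) : boundary (boundary x) = 0.
Proof.
pose F : {additive _ -> _} := @boundary R X n.-1 r \o @boundary R X n r.
apply: (@freeg_additive_ext _ _ F \0) => s; rewrite /F /= boundaryU.
rewrite cube_boundaryE raddf_sum.
pose G (p : ('I_n * bool) * ('I_n.-1 * bool)) : cubical_chain X n.-1.-1 r :=
  (-1) ^+ (p.1.1.+1 + p.1.2 + (p.2.1.+1 + p.2.2)) *: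
  << face p.2.1 p.2.2 (face p.1.1 p.1.2 s) >>.
pose h (p : ('I_n * bool) * ('I_n.-1 * bool)) :=
  ((fintype.lift p.1.1 p.2.1, p.2.2), (swap_coord p.1.1 p.2.1, p.1.2)).
have hK : involutive h.
  move=> [[i e] [j e']]; rewrite /h /= swap_coordK; congr ((_, _), (_, _)).
  apply: (@lift_inj _ i).
  by have := swap_coordK (fintype.lift i j) (swap_coord i j); rewrite (swap_coordK i j).
have Gh p : G (h p) = - G p.
  case: p => [[i e] [j e']]; rewrite /G /h /= -face_face -scaleNr; congr (_ *: _).
  rewrite -signr_odd -[in RHS]signr_odd -signrN; congr (_ ^+ (nat_of_bool _)).
  rewrite !oddD /= swap_coordE /bump.
  case: (leqP i j) => ij.
    by rewrite /=; case: (odd i); case: (odd j); case: e; case: e'.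
  rewrite add0n -(prednK (leq_ltn_trans (leq0n _) ij)) /=.
  by case: (odd i.-1); case: (odd j); case: e; case: e'.
have -> : \sum_(p : 'I_n * bool)
    boundary ((-1) ^+ (p.1.+1 + p.2) *: << face p.1 p.2 s >>) = \sum_p G p.
  rewrite -(pair_bigA _ (fun p q => G (p, q))); apply: eq_bigr => p _.
  rewrite -signr_odd scaler_sign.
  have -> : boundary (if odd (p.1.+1 + p.2) then - << face p.1 p.2 s >>
                      else << face p.1 p.2 s >>) =
            (-1) ^+ (p.1.+1 + p.2) *: cube_boundary (face p.1 p.2 s).
    by rewrite -signr_odd scaler_sign; case: odd; rewrite ?raddfN /= boundaryU.
  rewrite cube_boundaryE scaler_sumr; apply: eq_bigr => q _.
  by rewrite scalerA -exprD.
set S := \sum_p _.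
have SN : S = - S.
  rewrite {1}/S (reindex_inj (inv_inj hK)) /= -sumrN.
  by apply: eq_bigr => p _; rewrite Gh.
apply/eqP/freeg_eqP => k; rewrite coeff0.
by move/(congr1 (coeff k)): SN; rewrite coeffN; lia.
Qed.

End BoundaryBoundary.

Definition reduced_chain (R : realType) (X : metricType R) (n : nat) (r : R) :
    zmodType :=
  Quotient.quot (degenerate_chain X n r).

Definition reduced_boundary (R : realType) (X : metricType R) n r :
    {additive reduced_chain X n r -> reduced_chain X n.-1 r} :=
  quot_map (@boundary_degenerate R X n r).

Lemma reduced_boundaryE (R : realType) (X : metricType R) n r
    (x : cubical_chain X n r) :
  reduced_boundary X n r (\pi_(Quotient.quot (degenerate_chain X n r)) x) =
  \pi_(Quotient.quot (degenerate_chain X n.-1 r)) (boundary x).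
Proof. exact: quot_mapE. Qed.

Lemma reduced_boundary_boundary (R : realType) (X : metricType R) n r
    (x : reduced_chain X n r) :
  reduced_boundary X n.-1 r (reduced_boundary X n r x) = 0.
Proof.
by elim/quotW: x => x; rewrite !reduced_boundaryE boundary_boundary raddf0.
Qed.

Definition DH (R : realType) (X : metricType R) (n : nat) (r : R) : zmodType :=
  homology (reduced_boundary X n.+1 r) (reduced_boundary X n r).

Section Functoriality.
Variables (R : realType).
Implicit Types X Y Z : metricType R.

Definition controlled X Y (f : X -> Y) (r s : R) :=
  forall x1 x2, mdist x1 x2 <= r -> mdist (f x1) (f x2) <= s.

Lemma controlled_id X (r s : R) : r <= s -> controlled (@id X) r s.
Proof. by move=> rs x1 x2 /le_trans; apply. Qed.

Section Map.
Variables (X Y : metricType R) (f : X -> Y) (r s : R).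
Hypothesis fC : controlled f r s.

Lemma cube_map_subproof n (c : cube X n r) :
  is_cube s [ffun a : hypercube n => f (c a)].
Proof.
apply: adjacent_is_cube => a b ab; rewrite !ffunE; apply: fC.
by rewrite (le_trans (cube_lipschitz _ _ _))// ab mulr1.
Qed.

Definition cube_map n (c : cube X n r) : cube Y n s := Cube (cube_map_subproof c).

Lemma face_cube_map n (i : 'I_n) e (c : cube X n r) :
  face i e (cube_map c) = cube_map (face i e c).
Proof. by apply/val_inj/ffunP => a; rewrite /= !ffunE. Qed.

Definition chain_map n : cubical_chain X n r -> cubical_chain Y n s :=
  fglift (fun c : cube X n r => << cube_map c >> : cubical_chain Y n s).
Arguments chain_map n _ : clear implicits.

HB.instance Definition _ n := GRing.isZmodMorphism.Build
  (cubical_chain X n r) (cubical_chain Y n s) (chain_map n)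
  (lift_is_additive (fun c : cube X n r => << cube_map c >> : cubical_chain Y n s)).

Lemma chain_mapU n (c : cube X n r) : chain_map n << c >> = << cube_map c >>.
Proof. by rewrite /chain_map liftU scale1r. Qed.

Lemma chain_map_boundary n (x : cubical_chain X n r) :
  chain_map n.-1 (boundary x) = boundary (chain_map n x).
Proof.
pose F : {additive _ -> _} := chain_map n.-1 \o @boundary R X n r.
pose G : {additive _ -> _} := @boundary R Y n s \o chain_map n.
apply: (@freeg_additive_ext _ _ F G) => c.
rewrite /F /G /= chain_mapU !boundaryU /cube_boundary raddf_sum.
apply: eq_bigr => i _; rewrite -signr_odd !scaler_sign.
by case: odd; rewrite ?raddfN raddfB /= !chain_mapU !face_cube_map.
Qed.

Lemma chain_map_degenerate n (x : cubical_chain X n r) :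
  x \in degenerate_chain X n r -> chain_map n x \in degenerate_chain Y n s.
Proof.
apply: subgroup_gen_homo => _ [c /existsP[i /eqP ci] <-] /=.
rewrite chain_mapU; apply: subgroup_gen_sub; exists (cube_map c) => //.
by apply/existsP; exists i; rewrite !face_cube_map ci.
Qed.

Definition reduced_chain_map n :
    {additive reduced_chain X n r -> reduced_chain Y n s} :=
  quot_map (@chain_map_degenerate n).

Lemma reduced_chain_mapE n (x : cubical_chain X n r) :
  reduced_chain_map n (\pi_(Quotient.quot (degenerate_chain X n r)) x) =
  \pi_(Quotient.quot (degenerate_chain Y n s)) (chain_map n x).
Proof. exact: quot_mapE. Qed.

Lemma reduced_chain_map_boundary n (x : reduced_chain X n r) :
  reduced_chain_map n.-1 (reduced_boundary X n r x) =
  reduced_boundary Y n s (reduced_chain_map n x).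
Proof.
elim/quotW: x => x.
by rewrite reduced_boundaryE !reduced_chain_mapE reduced_boundaryE chain_map_boundary.
Qed.

Definition DH_map n : {additive DH X n r -> DH Y n s} :=
  homology_map (@reduced_chain_map_boundary n.+1) (@reduced_chain_map_boundary n).

Lemma DH_mapE n (z : cycle (reduced_boundary X n r)) :
  DH_map n (\pi_(Quotient.quot
      (boundaries (reduced_boundary X n.+1 r) (reduced_boundary X n r))) z) =
  \pi_(Quotient.quot
      (boundaries (reduced_boundary Y n.+1 s) (reduced_boundary Y n s)))
    (cycle_map (@reduced_chain_map_boundary n) z).
Proof. exact: homology_mapE. Qed.

End Map.

Arguments chain_map {X Y f r s} fC n _.

Lemma DH_map_comp X Y Z (f : X -> Y) (g : Y -> Z) (h : X -> Z) (r s t : R)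
    (fC : controlled f r s) (gC : controlled g s t) (hC : controlled h r t) n :
  (forall x, g (f x) = h x) -> forall x, DH_map gC n (DH_map fC n x) = DH_map hC n x.
Proof.
move=> gf; elim/quotW => z; rewrite (DH_mapE fC) (DH_mapE gC) (DH_mapE hC).
congr (\pi_(_) _).
apply: val_inj => /=; elim/quotW: (cycle_val z) => {}z.
rewrite (reduced_chain_mapE fC) (reduced_chain_mapE gC) (reduced_chain_mapE hC).
congr (\pi_(_) _).
pose F : {additive _ -> _} := chain_map gC n \o chain_map fC n.
apply: (@freeg_additive_ext _ _ F (chain_map hC n)) => c.
rewrite /F /= !chain_mapU; congr << _ >>.
by apply/val_inj/ffunP => a; rewrite /= !ffunE.
Qed.

Lemma DH_map_id X (r : R) (h : controlled (@id X) r r) n x : DH_map h n x = x.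
Proof.
elim/quotW: x => z; rewrite (DH_mapE h); congr (\pi_(_) _).
apply: val_inj => /=; elim/quotW: (cycle_val z) => {}z.
rewrite (reduced_chain_mapE h); congr (\pi_(_) _).
apply: (@freeg_additive_ext _ _ (chain_map h n) idfun) => c.
rewrite /= chain_mapU; congr << _ >>.
by apply/val_inj/ffunP => a; rewrite /= !ffunE.
Qed.
End Functoriality.

Section CoarseNotions.
Variable R : realType.
Implicit Types X Y : metricType R.

Definition proper_space X :=
  forall (x : X) (r : R), compact [set y | mdist x y <= r].

(* any two points are joined by a finite chain with steps of length at most r *)
Definition connected_at X (r : R) :=
  forall x y : X, exists s : seq X,
    path (fun a b => mdist a b <= r) x s /\ last x s = y.

Definition coarsely_connected X := exists2 r : R, 0 < r & connected_at X r.

Definition proper_map X Y (f : X -> Y) :=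
  forall K : set Y, compact K -> compact (f @^-1` K).

Definition uniformly_bornologous X Y (f : X -> Y) :=
  exists S : R -> R, forall r, 0 < r ->
    0 < S r /\ forall x1 x2, mdist x1 x2 < r -> mdist (f x1) (f x2) < S r.

Record UBP X Y := MkUBP {
  UBP_fun :> X -> Y;
  UBP_bornologous : uniformly_bornologous UBP_fun;
  UBP_proper : proper_map UBP_fun
}.

Definition bornotopic X Y (f g : X -> Y) :=
  exists2 M : R, 0 < M & forall x, mdist (f x) (g x) < M.

Definition bornotopy_equivalence X Y (f : UBP X Y) :=
  exists g : UBP Y X, bornotopic (f \o g) id /\ bornotopic (g \o f) id.

Lemma connected_at_le X r s : r <= s -> connected_at X r -> connected_at X s.
Proof.
move=> rs cX x y; have [p [xp <-]] := cX x y; exists p; split=> //.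
by apply: sub_path xp => a b /= /le_trans; apply.
Qed.

End CoarseNotions.

Section CoarseHomology.
Variable R : realType.
Implicit Types X Y : metricType R.

(* the product over k = 1, 2, ... is indexed by nat *)
Definition DHprod X (n : nat) (r : R) : zmodType := nat -> DH X n r.

Definition DHprod_map X Y (f : X -> Y) r s (fC : controlled f r s) n :
    DHprod X n r -> DHprod Y n s :=
  fun c k => DH_map fC n (c k).

Arguments DHprod_map {X Y f r s} fC n _.

Lemma DHprod_map_comp X Y (Z : metricType R) (f : X -> Y) (g : Y -> Z)
    (h : X -> Z) (r s t : R)
    (fC : controlled f r s) (gC : controlled g s t) (hC : controlled h r t) n c :
  (forall x, g (f x) = h x) ->
  DHprod_map gC n (DHprod_map fC n c) = DHprod_map hC n c.
Proof. by move=> gf; apply/funext => k; exact: (DH_map_comp fC gC hC). Qed.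

Lemma DHprod_map_morphism X Y (f : X -> Y) r s (fC : controlled f r s) n :
  zmod_morphism (@DHprod_map X Y f r s fC n).
Proof. by move=> c d; apply/funext => k; rewrite /DHprod_map raddfB. Qed.

HB.instance Definition _ X Y (f : X -> Y) r s (fC : controlled f r s) n :=
  GRing.isZmodMorphism.Build (DHprod X n r) (DHprod Y n s)
    (@DHprod_map X Y f r s fC n) (@DHprod_map_morphism X Y f r s fC n).

(* the values of r over which the direct limit is taken *)
Definition is_scale X (r : R) : bool := (0 < r) && `[< connected_at X r >].
Definition scale X := {r : R | is_scale X r}.

Section DirectedSystem.
Variables (X : metricType R) (cX : coarsely_connected X) (n : nat).

Lemma scale_exists : exists r : R, is_scale X r.
Proof. by case: cX => r r0 cr; exists r; rewrite /is_scale r0; apply/asboolP. Qed.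

Definition scale0 : scale X := exist (is_scale X) _ (xchooseP scale_exists).

Definition scale_le : rel (scale X) := fun r s => val r <= val s.

Lemma scale_directed r s : exists t, scale_le r t && scale_le s t.
Proof.
rewrite /scale_le; case/orP: (le_total (val r) (val s)) => rs.
  by exists s; rewrite rs /=.
by exists r; rewrite rs lexx.
Qed.

Definition DH_trans r s (h : scale_le r s) :
    {additive DHprod X n (val r) -> DHprod X n (val s)} :=
  @DHprod_map X X id _ _ (@controlled_id R X _ _ h) n.

Lemma DH_trans_id r (h : scale_le r r) x : DH_trans h x = x.
Proof. by apply/funext => k; rewrite /= /DHprod_map DH_map_id. Qed.

Lemma DH_trans_comp r s t (hrs : scale_le r s) (hst : scale_le s t)
  (hrt : scale_le r t) x : DH_trans hst (DH_trans hrs x) = DH_trans hrt x.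
Proof. by apply/funext => k; apply: DH_map_comp. Qed.

Definition DH_system : directSystem :=
  @DirectSystem (scale X) scale_le (fun r => DHprod X n (val r)) DH_trans scale0
    (fun r => lexx (val r)) (fun _ _ _ => @le_trans _ _ _ _ _)
    scale_directed DH_trans_id DH_trans_comp.

Definition DHoo : zmodType := dlim DH_system.

Definition DHoo_in (r : scale X) : DHprod X n (val r) -> DHoo :=
  @dlim_in DH_system r.

Lemma DHoo_in_morphism r : zmod_morphism (@DHoo_in r).
Proof. exact: (@dlim_in_morphism DH_system r). Qed.

HB.instance Definition _ r :=
  GRing.isZmodMorphism.Build (DHprod X n (val r)) DHoo (@DHoo_in r)
    (@DHoo_in_morphism r).

End DirectedSystem.

Arguments DHoo_in {X} cX n r _.

Section InducedMap.
Variables (X Y : metricType R).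
Variables (cX : coarsely_connected X) (cY : coarsely_connected Y).
Variable f : UBP X Y.

Lemma controlling_scale (r : scale X) :
  exists s : scale Y, controlled f (val r) (val s).
Proof.
have [S SP] := UBP_bornologous f; have [t t0 ct] := cY.
have r0 : 0 < val r by case/andP: (valP r).
have [_ fS] := SP (val r + 1) (addr_gt0 r0 ltr01).
have P : is_scale Y (Num.max t (S (val r + 1))).
  rewrite /is_scale lt_max t0 /=; apply/asboolP; apply: connected_at_le ct.
  by rewrite le_max lexx.
exists (exist (is_scale Y) _ P) => x1 x2 x12; rewrite /= le_max; apply/orP; right.
by apply/ltW/fS; rewrite (le_lt_trans x12)// ltrDl.
Qed.

Definition target_scale (r : scale X) : scale Y := sval (cid (controlling_scale r)).
Definition target_scaleP r : controlled f (val r) (val (target_scale r)) :=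
  svalP (cid (controlling_scale r)).

Variable n : nat.

Definition DHoo_stage (r : scale X) :
    {additive DHprod X n (val r) -> DHprod Y n (val (target_scale r))} :=
  DHprod_map (@target_scaleP r) n.

(* the image in the limit does not depend on the scales *)
Lemma DHoo_independent (r r' : scale X) (s s' : scale Y) (h : scale_le r r')
    (fC : controlled f (val r) (val s)) (fC' : controlled f (val r') (val s')) c :
  DHoo_in cY n s' (DHprod_map fC' n (DH_trans n h c)) =
  DHoo_in cY n s (DHprod_map fC n c).
Proof.
have [t /andP[st st']] := scale_directed s s'.
apply/dlim_inP; exists t, st', st.
have fCt : controlled f (val r) (val t).
  by move=> x1 x2 /fC /le_trans; apply.
have fC'' : controlled f (val r) (val s').
  by move=> x1 x2 x12; apply: fC'; exact: le_trans x12 h.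
have e : DHprod_map fC' n (DH_trans n h c) = DHprod_map fC'' n c.
  exact: DHprod_map_comp.
apply: etrans (congr1 (DH_trans n st') e) _.
apply: (etrans (y := DHprod_map fCt n c)); first exact: DHprod_map_comp.
by apply: esym; exact: DHprod_map_comp.
Qed.

Lemma DHoo_compatible :
  @dlim_compatible (DH_system cX n) (DH_system cY n) target_scale DHoo_stage.
Proof. by move=> r r' h c; apply: DHoo_independent. Qed.

Definition DHoo_map : {additive DHoo cX n -> DHoo cY n} := dlim_map DHoo_compatible.

Lemma DHoo_mapE (r : scale X) (s : scale Y) (fC : controlled f (val r) (val s)) c :
  DHoo_map (DHoo_in cX n r c) = DHoo_in cY n s (DHprod_map fC n c).
Proof.
rewrite [LHS](dlim_mapE DHoo_compatible).
rewrite -[RHS](DHoo_independent (lexx (val r)) fC (@target_scaleP r)).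
by rewrite DH_trans_id.
Qed.

End InducedMap.
End CoarseHomology.

(* Main.v *)
Require Import Defs.
From HB Require Import structures.
From mathcomp Require Import all_boot all_order all_algebra.
From mathcomp Require Import generic_quotient ring_quotient freeg.
From mathcomp Require Import boolp reals metric_structure.
Import Order.TTheory GRing.Theory Num.Theory.

(** If [f, g : X -> Y] are within distance [s] of each other and both send
    [r]-close points to [s]-close points, then gluing [f \o c] and [g \o c] along
    a new first coordinate turns an [(n,r)]-cube [c] of [X] into an
    [(n+1,s)]-cube of [Y]. This prism operator is a chain homotopy, so [f] and
    [g] agree on [DH_{n,r}(X) -> DH_{n,s}(Y)]. A bornotopy inverse [g] of [f]
    therefore induces an inverse of [f_*] once the scale exceeds the
    distance from [g \o f] (resp. [f \o g]) to the identity. *)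

Set Implicit Arguments.
Unset Strict Implicit.
Unset Printing Implicit Defensive.

Local Open Scope quotient_scope.
Local Open Scope ring_scope.

Definition cube_tail n (a : hypercube n.+1) : hypercube n :=
  [ffun j => a (fintype.lift ord0 j)].

Lemma cube_tail_insert0 n e (a : hypercube n) :
  cube_tail (insert_coord (ord0 : 'I_n.+1) e a) = a.
Proof. by apply/ffunP => j; rewrite !ffunE liftK. Qed.

Lemma cube_tail_insert n (i : 'I_n.+1) e (a : hypercube n.+1) :
  cube_tail (insert_coord (fintype.lift ord0 i : 'I_n.+2) e a) =
  insert_coord i e (cube_tail a).
Proof.
apply/ffunP => j; rewrite !ffunE.
case: (unliftP i j) => [k ->|->]; last by rewrite unlift_none.
have -> : fintype.lift ord0 (fintype.lift i k) =
    fintype.lift (fintype.lift ord0 i) (fintype.lift ord0 k).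
  by apply: val_inj; rewrite /= /bump /= !add1n ltnS addnS.
by rewrite liftK ffunE.
Qed.

(** Splits the edges of the prism into two kinds: those along the new coordinate, with equal tails,
    and those inside one end. *)
Lemma hamming_tail n (a b : hypercube n.+1) :
  hamming a b = ((a ord0 != b ord0) + hamming (cube_tail a) (cube_tail b))%N.
Proof.
rewrite /hamming -!sum1_card big_mkcond big_ord_recl /= inE; congr (_ + _)%N.
by rewrite [RHS]big_mkcond; apply: eq_bigr => i _; rewrite !inE !ffunE.
Qed.

Section Prism.
Variables (R : realType) (X Y : metricType R) (f g : X -> Y) (r s : R).
Hypotheses (fC : controlled f r s) (gC : controlled g r s).
Hypothesis fg : forall x, mdist (f x) (g x) <= s.

Lemma prism_subproof n (c : cube X n r) :
  is_cube s [ffun a : hypercube n.+1 =>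
    (if a ord0 then g else f) (c (cube_tail a))].
Proof.
apply: adjacent_is_cube => a b; rewrite !ffunE hamming_tail.
have [ab0|ab0] := eqVneq (a ord0) (b ord0); rewrite ?add0n ?add1n => ab.
  have cab : mdist (c (cube_tail a)) (c (cube_tail b)) <= r.
    by rewrite (le_trans (cube_lipschitz _ _ _))// ab mulr1.
  by rewrite ab0; case: (b ord0); [exact: gC|exact: fC].
(* The edge runs along the new coordinate, so its ends are the images under [f] and [g] of one
   point. *)
case: ab => /hamming_eq0 ->; move: ab0.
by case: (a ord0); case: (b ord0) => // _; rewrite 1?metric_sym fg.
Qed.

Definition prism n (c : cube X n r) : cube Y n.+1 s := Cube (prism_subproof c).

Lemma face0_prism n e (c : cube X n r) :
  face ord0 e (prism c) = if e then cube_map gC c else cube_map fC c.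
Proof.
apply/val_inj/ffunP => a; rewrite /= !ffunE unlift_none /=.
rewrite (cube_tail_insert0 e (a : hypercube n)).
by case: e; rewrite /= ffunE.
Qed.

(** The glued coordinate is the first, so direction [i] of [c] becomes direction [lift ord0 i] of
    its prism. *)
Lemma face_prism n (i : 'I_n.+1) e (c : cube X n.+1 r) :
  face (fintype.lift ord0 i) e (prism c) = prism (face i e c).
Proof.
apply/val_inj/ffunP => a; rewrite /= !ffunE /=.
rewrite (cube_tail_insert i e (a : hypercube n.+1)).
have -> : (ord0 : 'I_n.+2) =
    fintype.lift (fintype.lift ord0 i : 'I_n.+2) (ord0 : 'I_n.+1).
  exact: val_inj.
by rewrite liftK.
Qed.

Definition prism_chain n : cubical_chain X n r -> cubical_chain Y n.+1 s :=
  fglift (fun c : cube X n r => << prism c >> : cubical_chain Y n.+1 s).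
Arguments prism_chain n _ : clear implicits.

HB.instance Definition _ n := GRing.isZmodMorphism.Build
  (cubical_chain X n r) (cubical_chain Y n.+1 s) (prism_chain n)
  (lift_is_additive
    (fun c : cube X n r => << prism c >> : cubical_chain Y n.+1 s)).

Lemma prism_chainU n (c : cube X n r) : prism_chain n << c >> = << prism c >>.
Proof. by rewrite /prism_chain liftU scale1r. Qed.

Lemma prism_degenerate n (x : cubical_chain X n r) :
  x \in degenerate_chain X n r -> prism_chain n x \in degenerate_chain Y n.+1 s.
Proof.
move: x; apply: subgroup_gen_homo => _ [c /existsP[i /eqP ci] <-] /=.
rewrite prism_chainU; apply: subgroup_gen_sub; exists (prism c) => //.
(* A 0-cube has no direction, hence is never degenerate. *)
case: n c i ci => [c []//|n c i ci].
by apply/existsP; exists (fintype.lift ord0 i); rewrite !face_prism ci.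
Qed.

(** The first direction carries the sign -1, so the two ends contribute [g] minus [f]; the sum
    collects the lateral faces. *)
Lemma cube_boundary_prism n (c : cube X n r) :
  cube_boundary (prism c) = << cube_map gC c >> - << cube_map fC c >> +
    \sum_(i < n) (-1) ^+ i.+2 *: (<< face (fintype.lift ord0 i) false (prism c) >>
       - << face (fintype.lift ord0 i) true (prism c) >>).
Proof.
by rewrite /cube_boundary big_ord_recl !face0_prism expr1 scaleN1r opprB.
Qed.

(** Degree 0 stands apart: as [0.-1] is 0, the prism of [boundary x] would lie in degree 1, not
    0. *)
Lemma boundary_prism_chain0 (x : cubical_chain X 0 r) :
  boundary (prism_chain 0 x) = chain_map gC x - chain_map fC x.
Proof.
pose F : {additive _ -> _} := @boundary R Y 1 s \o prism_chain 0.
pose G : {additive _ -> _} := @chain_map R X Y g r s gC 0 \- @chain_map R X Y f r s fC 0.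
apply: (@freeg_additive_ext _ _ F G) => c.
rewrite /F /G /= prism_chainU boundaryU cube_boundary_prism big_ord0 addr0.
by rewrite !chain_mapU.
Qed.

Lemma boundary_prism_chain n (x : cubical_chain X n.+1 r) :
  boundary (prism_chain n.+1 x) + prism_chain n (boundary x) =
  chain_map gC x - chain_map fC x.
Proof.
pose F : {additive _ -> _} :=
  (@boundary R Y n.+2 s \o prism_chain n.+1) \+ (prism_chain n \o @boundary R X n.+1 r).
pose G : {additive _ -> _} :=
  @chain_map R X Y g r s gC n.+1 \- @chain_map R X Y f r s fC n.+1.
apply: (@freeg_additive_ext _ _ F G) => c.
rewrite /F /G /= prism_chainU !boundaryU cube_boundary_prism !chain_mapU.
rewrite -addrA [X in _ + X](_ : _ = 0) ?addr0//.
rewrite raddf_sum -big_split big1//= => i _.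
(* The shift of directions by one flips the sign, so each lateral face cancels the prism on the
   corresponding face of [c]. *)
rewrite !face_prism (exprS _ i.+1) mulN1r scaleNr -signr_odd !scaler_sign.
by case: odd; rewrite /= ?opprK ?(raddfN (prism_chain n)) (raddfB (prism_chain n)) /=
  !prism_chainU ?subrr ?addNr.
Qed.

Definition reduced_prism n :
    {additive reduced_chain X n r -> reduced_chain Y n.+1 s} :=
  quot_map (@prism_degenerate n).

Lemma reduced_prismE n (x : cubical_chain X n r) :
  reduced_prism n (\pi_(Quotient.quot (degenerate_chain X n r)) x) =
  \pi_(Quotient.quot (degenerate_chain Y n.+1 s)) (prism_chain n x).
Proof. exact: quot_mapE. Qed.

(** On cycles the term with the prism of the boundary vanishes, so degree 0 and positive degrees
    share one formula. *)
Lemma reduced_boundary_prism n (x : reduced_chain X n r) :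
  reduced_boundary X n r x = 0 ->
  reduced_boundary Y n.+1 s (reduced_prism n x) =
  reduced_chain_map gC n x - reduced_chain_map fC n x.
Proof.
case: n x => [|n]; elim/quotW => x.
  move=> _; rewrite reduced_prismE reduced_boundaryE !reduced_chain_mapE.
  by rewrite boundary_prism_chain0 raddfB.
rewrite reduced_boundaryE => /(congr1 (reduced_prism n)).
rewrite reduced_prismE raddf0 => dx.
rewrite !reduced_chain_mapE -raddfB -boundary_prism_chain raddfD /= dx addr0.
by rewrite reduced_prismE reduced_boundaryE.
Qed.

Lemma DH_map_close n x : DH_map fC n x = DH_map gC n x.
Proof.
elim/quotW: x => z; rewrite (DH_mapE fC) (DH_mapE gC); apply/esym/eqP.
rewrite -Quotient.idealrBE; apply/asboolP.
exists (reduced_prism n (cycle_val z)).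
by rewrite (reduced_boundary_prism (eqP (cycleP z))).
Qed.

End Prism.

Section BornotopyInverse.
Variables (R : realType) (X Y : metricType R).
Variables (cX : coarsely_connected X) (cY : coarsely_connected Y).

(** Connectedness persists at larger scales, so the maximum of [r] and [M] is again a scale. *)
Lemma scale_ge (r : scale X) (M : R) : exists t : scale X,
  scale_le r t && (M <= val t).
Proof.
have /andP[r0 /asboolP cr] := valP r.
have P : is_scale X (Num.max (val r) M).
  rewrite /is_scale lt_max r0; apply/asboolP.
  by apply: connected_at_le cr; rewrite le_max lexx.
by exists (exist (is_scale X) _ P); rewrite /scale_le /= !le_max !lexx orbT.
Qed.

Lemma DHoo_map_bornotopy_inv (f : UBP X Y) (g : UBP Y X) n :
  bornotopic (g \o f) id -> cancel (DHoo_map cX cY f n) (DHoo_map cY cX g n).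
Proof.
move=> [M _ gfM] x; rewrite -(dlim_eltK x); move: (dlim_index x) (dlim_elt x).
move=> r c; rewrite -[dlim_in c]/(@DHoo_in R X cX n r c).
have [s fC] := controlling_scale cY f r.
have [u gC] := controlling_scale cX g s.
have [v /andP[uv rv]] := scale_ge u (val r).
(* [t] exceeds [u], to keep [g] controlled; [r], for the transition map to exist; and [M], for the
   prism between [g \o f] and the identity. *)
have [t /andP[vt Mt]] := scale_ge v M.
have rt : scale_le r t := le_trans rv vt.
have gC' : controlled g (val s) (val t).
  by move=> x1 x2 /gC /le_trans; apply; exact: le_trans uv vt.
rewrite (DHoo_mapE cX cY fC) (DHoo_mapE cY cX gC').
have hC : controlled (g \o f) (val r) (val t) by move=> x1 x2 /fC /gC'.
rewrite (DHprod_map_comp fC gC' hC)//.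
(* Moving [c] to stage [t] puts both sides at one stage: there [g \o f] is compared with the
   identity, component by component. *)
rewrite -[RHS](@dlim_in_map (DH_system cX n) _ _ rt); congr (DHoo_in _ _).
apply/funext => k; apply: DH_map_close => y.
by rewrite (le_trans (ltW (gfM y))).
Qed.

End BornotopyInverse.

Theorem theorem1p5 (R : realType) (X Y : metricType R)
    (pX : proper_space X) (pY : proper_space Y)
    (cX : coarsely_connected X) (cY : coarsely_connected Y)
    (f : UBP X Y) (hf : bornotopy_equivalence f) (n : nat) :
  zmod_morphism (DHoo_map cX cY f n) /\ bijective (DHoo_map cX cY f n).
Proof.
split; first exact: raddfB.
have [g [fg gf]] := hf.
(* [gf] gives one cancellation and [fg], with [f] and [g] exchanged, the other. *)
by exists (DHoo_map cY cX g n); exact: DHoo_map_bornotopy_inv.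
Qed.
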